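(* Let $n\ge 1$ and let $A,B\in \mathrm{SGL}_n(\mathbb{F}_2)$ be such that $B-A=\sum_{i=1}^{r+1}\mathbf{x}_i\mathbf{x}_i^{\top}$, where $r>0$ is even, $\mathbf{x}_1,\ldots,\mathbf{x}_r\in\mathbb{F}_2^n$ are linearly independent and $\mathbf{x}_{r+1}=\sum_{i=1}^r\mathbf{x}_i$. (i) If the $(r+1)\times(r+1)$ matrix $[\mathbf{x}_i^{\top}A^{-1}\mathbf{x}_j]_{i,j=1}^{r+1}$ is not of rank one, then $d(A,B)=r+1$. (ii) If $[\mathbf{x}_i^{\top}A^{-1}\mathbf{x}_j]_{i,j=1}^{r+1}$ is of rank one, then $d(A,B)=r+2$.
   Context: $\mathbb{F}_2$ is the binary field. $\mathrm{SGL}_n(\mathbb{F}_2)$ is the set of invertible symmetric $n\times n$ matrices over $\mathbb{F}_2$. $\Gamma_n$ is the graph with vertex set $\mathrm{SGL}_n(\mathbb{F}_2)$ in which $A,B$ are adjacent iff $\mathrm{rank}(A-B)=1$; $d(A,B)$ denotes the graph distance in $\Gamma_n$. *)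

(* Defs.v *)
From HB Require Import structures.
From mathcomp Require Import all_boot all_order all_algebra.
Set Implicit Arguments. Unset Strict Implicit. Unset Printing Implicit Defensive.
Import GRing.Theory.
Local Open Scope ring_scope.

Notation F2 := 'F_2.

Definition sgl (n : nat) (A : 'M[F2]_n) : bool := (A^T == A) && (A \in unitmx).

Definition gamma_adj (n : nat) : rel 'M[F2]_n :=
  fun A B => [&& sgl A, sgl B & \rank (A - B) == 1%N].

Definition gamma_walk (n k : nat) (A B : 'M[F2]_n) : Prop :=
  sgl A /\ exists p : seq 'M[F2]_n,
    [/\ size p = k, path (@gamma_adj n) A p & last A p = B].

Definition gamma_dist (n : nat) (A B : 'M[F2]_n) (k : nat) : Prop :=
  gamma_walk k A B /\ forall m, (m < k)%N -> ~ gamma_walk m A B.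

(* Main.v *)
(* Write D = B - A, S = A^-1 and C = D S D. Over F2 the map v |-> v^T M v of a
   symmetric M is the linear form given by its diagonal, and a rank one
   symmetric matrix is y y^T, so a step is A' = A + y y^T with y^T S y = 0; it
   changes C into C + p y^T + y p^T + p p^T, where p = D S y.

   Lower bounds. The rank of D drops by at most one per step, and it cannot drop
   on a step from an alternate D; hence an alternate D of rank r needs r + 1 steps. If
   C = s s^T, a walk of length r + 1 can only use steps y in the column space
   of D; these have p = 0, so C never changes, although it must vanish at the end.

   Upper bounds. If D and D + C are not alternate and C is not of rank one, one
   can choose y = D v lowering the rank of D while keeping these properties:
   the admissible v fill an affine space of codimension at most 2, and the
   forbidden ones lie in at most 5 cosets of ker D (3 if rank D = 4, by parity
   of alternate ranks). Rank 3 is the only tight case, where failure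
   forces C to have rank one. An alternate D is reduced to this situation by
   one step inside its column space if C is not of rank one, and by one
   step outside of it otherwise. *)
Require Import Defs.
From mathcomp Require Import all_boot all_order all_algebra.
From mathcomp Require Import mxabelem zify.
Set Implicit Arguments. Unset Strict Implicit. Unset Printing Implicit Defensive.
Import GRing.Theory.
Local Open Scope ring_scope.

(** * Arithmetic and matrix addition over F2 *)

Lemma F2_cases (a : 'F_2) : a = 0 \/ a = 1.
Proof. by case: a => [[|[|//]] ?]; [left|right]; apply: val_inj. Qed.

Lemma F2_neq0 (a : 'F_2) : (a != 0) = (a == 1).
Proof. by case: (F2_cases a) => ->. Qed.

Lemma F2_sqr (a : 'F_2) : a * a = a.
Proof. by case: (F2_cases a) => ->; rewrite ?mulr0 ?mulr1. Qed.

Lemma addmm m n (A : 'M['F_2]_(m, n)) : A + A = 0.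
Proof. by apply/matrixP=> i j; rewrite !mxE; case: (F2_cases (A i j)) => ->; apply: val_inj. Qed.

Lemma F2_addrr (a : 'F_2) : a + a = 0.
Proof. by case: (F2_cases a) => ->; apply: val_inj. Qed.

Lemma oppmm m n (A : 'M['F_2]_(m, n)) : - A = A.
Proof. by apply/eqP; rewrite -subr_eq0 -opprD addmm oppr0. Qed.

Lemma addmK m n (A B : 'M['F_2]_(m, n)) : A + B + B = A.
Proof. by rewrite -addrA addmm addr0. Qed.

Lemma addm_eq0 m n (A B : 'M['F_2]_(m, n)) : (A + B == 0) = (A == B).
Proof. by rewrite addr_eq0 oppmm. Qed.

Lemma addmxE m n (A B : 'M['F_2]_(m, n)) i j : (A + B) i j = A i j + B i j.
Proof. by rewrite mxE. Qed.

Lemma zeromxE m n i j : (0 : 'M['F_2]_(m, n)) i j = 0.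
Proof. by rewrite mxE. Qed.

(* Decides additive identities between matrices over F2, entry by entry. *)
Ltac F2_group :=
  let i := fresh in let j := fresh in
  apply/matrixP => i j; rewrite ?(addmxE, zeromxE);
  repeat match goal with |- context [fun_of_matrix ?M i j] =>
    case: (F2_cases (M i j)) => -> end;
  exact/eqP.

(** * Linear forms, squares and diagonals *)

Definition dot n (u v : 'cV['F_2]_n) : 'F_2 := (u^T *m v) 0 0.
Definition sq n (y : 'cV['F_2]_n) : 'M['F_2]_n := y *m y^T.
Definition dg n (A : 'M['F_2]_n) : 'cV['F_2]_n := \col_i A i i.

Lemma mul_dot n (u v : 'cV['F_2]_n) : u^T *m v = (dot u v)%:M.
Proof. by rewrite {1}[_ *m _]mx11_scalar. Qed.

Lemma dotC n (u v : 'cV['F_2]_n) : dot u v = dot v u.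
Proof. by rewrite /dot -[in LHS](trmxK v) -trmx_mul mxE. Qed.

Lemma dotDr n (u v w : 'cV['F_2]_n) : dot u (v + w) = dot u v + dot u w.
Proof. by rewrite /dot mulmxDr mxE. Qed.

Lemma dotDl n (u v w : 'cV['F_2]_n) : dot (u + v) w = dot u w + dot v w.
Proof. by rewrite !(dotC _ w) dotDr. Qed.

Lemma dot0l n (v : 'cV['F_2]_n) : dot 0 v = 0.
Proof. by rewrite /dot trmx0 mul0mx mxE. Qed.

Lemma dot0r n (v : 'cV['F_2]_n) : dot v 0 = 0.
Proof. by rewrite dotC dot0l. Qed.

Lemma dot_mul n (M : 'M['F_2]_n) (u v : 'cV['F_2]_n) :
  M^T = M -> dot (M *m u) v = dot u (M *m v).
Proof. by move=> sM; rewrite /dot trmx_mul sM mulmxA. Qed.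

Lemma mul_dotr n (y u v : 'cV['F_2]_n) : y *m u^T *m v = dot u v *: y.
Proof. by rewrite -mulmxA mul_dot mul_mx_scalar. Qed.

Lemma sq_mul n (y v : 'cV['F_2]_n) : sq y *m v = dot y v *: y.
Proof. exact: mul_dotr. Qed.

Lemma sqT n (y : 'cV['F_2]_n) : (sq y)^T = sq y.
Proof. by rewrite /sq trmx_mul trmxK. Qed.

Lemma dgD n (A B : 'M['F_2]_n) : dg (A + B) = dg A + dg B.
Proof. by apply/matrixP=> i j; rewrite !mxE. Qed.

Lemma dg_sq n (y : 'cV['F_2]_n) : dg (sq y) = y.
Proof.
apply/matrixP=> i j; rewrite !mxE big_ord_recl big_ord0 addr0 !mxE.
by rewrite [j]ord1 F2_sqr.
Qed.

Lemma dg_sym n (B : 'M['F_2]_n) : dg (B + B^T) = 0.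
Proof. by apply/matrixP=> i j; rewrite !mxE F2_addrr. Qed.

Lemma dg_polar n (u v : 'cV['F_2]_n) : dg (u *m v^T + v *m u^T) = 0.
Proof. by rewrite -(dg_sym (u *m v^T)) trmx_mul trmxK. Qed.

(* Over F2 the quadratic form of a symmetric matrix is additive, hence linear. *)
Lemma dot_dg n (M : 'M['F_2]_n) (v : 'cV['F_2]_n) :
  M^T = M -> dot v (M *m v) = dot (dg M) v.
Proof.
move=> sM; pose q u := dot u (M *m u).
have qD u w : q (u + w) = q u + q w.
  rewrite /q mulmxDr !(dotDl, dotDr) -(dot_mul u w sM) (dotC (M *m u)).
  by rewrite -addrA [X in _ + X]addrA F2_addrr add0r.
have q0 : q 0 = 0 by rewrite /q dot0l.
rewrite -/(q v) [in LHS](matrix_sum_delta v) (big_morph q qD q0) /dot mxE.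
apply: eq_bigr => i _; rewrite big_ord_recl big_ord0 addr0 !mxE.
case: (F2_cases (v i 0)) => ->; first by rewrite scale0r q0 mulr0.
rewrite scale1r mulr1 /q /dot trmx_delta -rowE -colE.
by rewrite !mxE.
Qed.

Lemma dot_neq0 n (f : 'cV['F_2]_n) : f != 0 -> exists u, dot f u = 1.
Proof.
move=> f0; have [i fi] : exists i, f i 0 != 0.
  apply/existsP; apply: contraNT f0 => /existsPn f0; apply/eqP/matrixP=> i j.
  by rewrite [j]ord1 mxE; apply/eqP; rewrite -[_ == _]negbK f0.
exists (delta_mx i 0); rewrite /dot -colE !mxE; apply/eqP; rewrite -F2_neq0 //.
Qed.

Lemma dot_both1 n (f g : 'cV['F_2]_n) :
  f != 0 -> g != 0 -> exists u, dot f u = 1 /\ dot g u = 1.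
Proof.
move=> /dot_neq0[a fa] /dot_neq0[b gb].
case: (F2_cases (dot g a)) => ga; last by exists a.
case: (F2_cases (dot f b)) => fb; last by exists b.
by exists (a + b); rewrite !dotDr fa fb ga gb addr0 add0r.
Qed.

Lemma dot_separate n (f g : 'cV['F_2]_n) :
  f != 0 -> f != g -> exists u, dot f u = 1 /\ dot g u = 0.
Proof.
move=> f0 fg; have fg0 : f + g != 0 by rewrite addm_eq0.
have [u [fu]] := dot_both1 f0 fg0; rewrite dotDl fu => gu; exists u; split=> //.
by case: (F2_cases (dot g u)) gu => -> // /eqP.
Qed.

(** If [f] is none of the four, each of [d], [m] and [d + m] vanishes at some vector where [f] is 1.
    One of these three vectors, or their sum, then lies in both kernels and still has [f] equal to
    1. *)
Lemma dot_annihilator n (f d m : 'cV['F_2]_n) :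
    (forall u, dot d u = 0 -> dot m u = 0 -> dot f u = 0) ->
  [\/ f = 0, f = d, f = m | f = d + m].
Proof.
move=> H.
case: (eqVneq f 0) => [?|f0]; first by constructor 1.
case: (eqVneq f d) => [?|fd]; first by constructor 2.
case: (eqVneq f m) => [?|fm]; first by constructor 3.
case: (eqVneq f (d + m)) => [?|fdm]; first by constructor 4.
exfalso.
have [a [fa da]] := dot_separate f0 fd; have [b [fb mb]] := dot_separate f0 fm.
have [c [fc]] := dot_separate f0 fdm; rewrite dotDl => dmc.
have nz u : dot f u = 1 -> dot d u = 0 -> dot m u = 0 -> False.
  by move=> fu du mu; move: (H u du mu); rewrite fu.
case: (F2_cases (dot m a)) => ma; first exact: (nz a).
case: (F2_cases (dot d b)) => db; first exact: (nz b).
case: (F2_cases (dot d c)) => dc.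
  by apply: (nz c) => //; move: dmc; rewrite dc add0r.
have mc : dot m c = 1 by case: (F2_cases (dot m c)) dmc => // ->; rewrite dc => /eqP.
apply: (nz (a + b + c)); rewrite !dotDr ?fa ?fb ?fc ?da ?db ?dc ?ma ?mb ?mc //;
 exact/eqP.
Qed.

Lemma mulmx_neq0 m n (D : 'M['F_2]_(m, n)) :
  D != 0 -> exists u : 'cV['F_2]_n, D *m u != 0.
Proof.
rewrite -trmx_eq0 => /rowV0Pn[w /submxP[a ->]] H; exists a^T.
by rewrite -trmx_eq0 trmx_mul trmxK.
Qed.

(** * Rank of a symmetric matrix after adding a square *)

Lemma rank_sq n (y : 'cV['F_2]_n) : (\rank (sq y) <= 1)%N.
Proof. exact: leq_trans (mxrankM_maxl _ _) (rank_leq_col _). Qed.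

Lemma rank_addsq n (D : 'M['F_2]_n) (y : 'cV['F_2]_n) :
  (\rank (D + sq y)%R <= (\rank D).+1)%N.
Proof.
apply: leq_trans (mxrank_add _ _) _.
by rewrite -[(\rank D).+1]addn1 leq_add2l rank_sq.
Qed.

Lemma addsq_factor n (D : 'M['F_2]_n) (v : 'cV['F_2]_n) : D^T = D ->
  D + sq (D *m v) = (1%:M + D *m v *m v^T) *m D.
Proof.
by move=> sD; rewrite mulmxDl mul1mx /sq -(mulmxA (D *m v)) trmx_mul sD.
Qed.

Lemma mul_eq0_sub m1 m2 n (A : 'M['F_2]_(m1, n)) (B : 'M['F_2]_(m2, n)) (v : 'cV['F_2]_n) :
  (A <= B)%MS -> B *m v = 0 -> A *m v = 0.
Proof. by case/submxP=> W -> Bv; rewrite -mulmxA Bv mulmx0. Qed.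

(** The row space of the sum is strictly inside that of [D], because [v] is killed by the sum but
    not by [D]; one square changes the rank by at most one. *)
Lemma rank_addsq_drop n (D : 'M['F_2]_n) (v : 'cV['F_2]_n) :
  D^T = D -> dot v (D *m v) = 1 -> \rank D = (\rank (D + sq (D *m v))%R).+1.
Proof.
move=> sD Dvv; apply/eqP; rewrite eqn_leq; apply/andP; split.
  by rewrite -{1}(addmK D (sq (D *m v))) rank_addsq.
apply: rank_ltmx; rewrite ltmxE addsq_factor // submxMl /=.
apply/negP=> le; move: (Dvv); rewrite (mul_eq0_sub le) ?dot0r // -addsq_factor //.
by rewrite mulmxDl sq_mul (dotC (D *m v)) Dvv scale1r addmm.
Qed.

(** [E = 1 + D v v^T] is an involution since [v^T D v = 0], and [E D] is the sum. *)
Lemma rank_addsq_keep n (D : 'M['F_2]_n) (v : 'cV['F_2]_n) :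
  D^T = D -> dot v (D *m v) = 0 -> \rank (D + sq (D *m v))%R = \rank D.
Proof.
move=> sD Dvv; apply/eqP; rewrite eqn_leq addsq_factor // mxrankM_maxr /=.
set y := D *m v in Dvv *; set E := 1%:M + _.
rewrite -{1}(mul1mx D) (_ : 1%:M = E *m E); last first.
  rewrite {2}/E mulmxDr mulmx1 {2}/E mulmxDl mul1mx mulmxA mul_dotr Dvv.
  by rewrite scale0r mul0mx addr0 addmK.
by rewrite -(mulmxA E) mxrankM_maxr.
Qed.

(** For symmetric [D] the column space is the annihilator of the kernel; a suitable column of
    [cokermx D] serves as [u]. *)
Lemma kernel_separate n (D : 'M['F_2]_n) (y : 'cV['F_2]_n) :
  D^T = D -> (forall v, y <> D *m v) -> exists u, D *m u = 0 /\ dot y u = 1.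
Proof.
move=> sD yD; have : ~~ (y^T <= D)%MS.
  by apply/negP=> /submxP[w wE]; apply: (yD w^T); rewrite -[y]trmxK wE trmx_mul sD.
rewrite submxE => /eqP yK.
have [j yj] : exists j, (y^T *m cokermx D) 0 j != 0.
  apply/existsP; apply: contraT => /existsPn H; case: yK.
  by apply/matrixP=> i j; rewrite [i]ord1 [RHS]mxE; apply/eqP; rewrite -[_ == _]negbK.
exists (col j (cokermx D)); split; first by rewrite colE mulmxA mulmx_coker mul0mx.
by rewrite /dot colE mulmxA -colE mxE; apply/eqP; rewrite -F2_neq0.
Qed.

(** A kernel vector [u] of [D] with [y^T u = 1] gives [y = (D + y y^T) u], so going back to [D] is a
    rank drop. *)
Lemma rank_addsq_up n (D : 'M['F_2]_n) (y : 'cV['F_2]_n) :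
  D^T = D -> (forall v, y <> D *m v) -> \rank (D + sq y)%R = (\rank D).+1.
Proof.
move=> sD yD; have [u [Du yu]] := kernel_separate sD yD.
have sD' : (D + sq y)^T = D + sq y by rewrite linearD /= sD sqT.
have yE : y = (D + sq y) *m u by rewrite mulmxDl Du add0r sq_mul yu scale1r.
by have := rank_addsq_drop (v := u) sD'; rewrite -yE addmK dotC => ->.
Qed.

(* Peel off a hyperbolic pair. *)
Lemma alternate_rank_even n (D : 'M['F_2]_n) : D^T = D -> dg D = 0 -> ~~ odd (\rank D).
Proof.
have [k rD] := ubnP (\rank D); elim: k D rD => // k IH D; rewrite ltnS => rD sD dD.
case: (eqVneq D 0) => [->|D0]; first by rewrite mxrank0.
have alt w : dot w (D *m w) = 0 by rewrite dot_dg // dD dot0l.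
have [u Du] := mulmx_neq0 D0.
have [v uv] := dot_neq0 Du.
have vu : dot (D *m v) u = 1 by rewrite dot_mul // dotC.
set y := D *m u in Du uv; set z := D *m v in vu.
pose P := y *m z^T + z *m y^T.
have sP : P^T = P by rewrite /P linearD /= !trmx_mul !trmxK addrC.
pose D' := D + P.
have sD' : D'^T = D' by rewrite /D' linearD /= sD sP.
have dD' : dg D' = 0 by rewrite dgD dD dg_polar addr0.
have yu : dot y u = 0 by rewrite dotC alt.
have zv : dot z v = 0 by rewrite dotC alt.
have D'u : D' *m u = 0.
  by rewrite /D' /P !mulmxDl !mul_dotr vu yu scale0r scale1r addr0 addmm.
have D'v : D' *m v = 0.
  by rewrite /D' /P !mulmxDl !mul_dotr zv uv scale0r scale1r add0r addmm.
have yD : (y^T <= D)%MS by rewrite trmx_mul sD submxMl.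
have zD : (z^T <= D)%MS by rewrite trmx_mul sD submxMl.
have PD : (P <= D)%MS.
  by apply: addmx_sub; apply: submx_trans (submxMl _ _) _.
have D'D : (D' <= D)%MS by apply: addmx_sub.
(* Two strict inclusions make the rank fall by at least 2: [u] kills [D'] but not [z^T], and [v]
   kills both of these but not [y^T]. *)
have lt1 : (D' < D' + z^T)%MS.
  rewrite ltmxE addsmxSl /=; apply/negP => H.
  have := mul_eq0_sub (submx_trans (addsmxSr _ _) H) D'u.
  by rewrite mul_dot vu => /matrixP/(_ 0 0); rewrite !mxE.
have lt2 : (D' + z^T < D)%MS.
  rewrite ltmxE addsmx_sub D'D zD /=; apply/negP => H.
  have : (D' + z^T <= kermx v)%MS.
    by rewrite addsmx_sub !sub_kermx D'v mul_dot zv -scalemx1 scale0r !eqxx.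
  move/(submx_trans (submx_trans yD H)); rewrite sub_kermx mul_dot uv.
  by move/eqP/matrixP/(_ 0 0); rewrite !mxE.
move/rank_ltmx: lt1 => lt1; move/rank_ltmx: lt2 => lt2.
have le : (\rank D <= \rank D' + 2)%N.
  rewrite -(addmK D P) -/D' (leq_trans (mxrank_add _ _)) // leq_add2l.
  apply: leq_trans (mxrank_add _ _) _.
  by apply: (@leq_add _ _ 1 1); apply: leq_trans (mxrankM_maxl _ _) (rank_leq_col _).
have rE : \rank D = (\rank D').+2 by lia.
by rewrite rE /= negbK IH //; lia.
Qed.

(** * Counting solutions of linear systems *)

Lemma card_kernel m n (A : 'M['F_2]_(m, n)) :
  #|[set v : 'cV['F_2]_n | A *m v == 0]| = (2 ^ (n - \rank A))%N.
Proof.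
rewrite -(card_imset _ (can_inj (@trmxK _ n 1))).
have -> : [set v^T | v in [set v : 'cV['F_2]_n | A *m v == 0]] = rowg (kermx A^T).
  apply/setP=> w; rewrite inE sub_kermx; apply/imsetP/eqP.
    by case=> v; rewrite inE => /eqP Av ->; rewrite -trmx_mul Av trmx0.
  move=> H; exists w^T; rewrite ?trmxK // inE -[A]trmxK -trmx_mul H trmx0 //.
by rewrite card_rowg mxrank_ker mxrank_tr card_Fp.
Qed.

Lemma card_fiber m n (A : 'M['F_2]_(m, n)) v0 :
  #|[set v : 'cV['F_2]_n | A *m v == A *m v0]| = (2 ^ (n - \rank A))%N.
Proof.
rewrite -card_kernel -[in LHS](card_imset _ (addIr v0)).
congr #|pred_of_set _|; apply/setP=> w; rewrite inE; apply/imsetP/eqP.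
  by case=> v; rewrite inE => /eqP Av ->; rewrite mulmxDr Av addmm.
move=> H; exists (w + v0); last by rewrite addmK.
by rewrite inE mulmxDr H add0r.
Qed.

Lemma card_fiber_le m n (A : 'M['F_2]_(m, n)) t :
  (#|[set v : 'cV['F_2]_n | A *m v == t]| <= 2 ^ (n - \rank A))%N.
Proof.
have [->|[v0]] := set_0Vmem [set v : 'cV['F_2]_n | A *m v == t]; first by rewrite cards0.
by rewrite inE => /eqP <-; rewrite card_fiber.
Qed.

Lemma avoid_sets (T : finType) c (K : {set T}) (Fs : seq {set T}) :
    (forall F, F \in Fs -> #|F| <= c)%N -> (size Fs * c < #|K|)%N ->
  exists2 v, v \in K & forall F, F \in Fs -> v \notin F.
Proof.
elim: Fs K => [|F Fs IH] K le lt.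
  have [K0|[v vK]] := set_0Vmem K; first by rewrite K0 cards0 in lt.
  by exists v.
have [||v] := IH (K :\: F).
- by move=> F' F'in; apply: le; rewrite inE F'in orbT.
- have := le F (mem_head _ _); rewrite -(cardsID F K) /= in lt *.
  have := subset_leq_card (subsetIr K F); move: lt; rewrite /= mulSn; lia.
rewrite inE => /andP[vF vK] H; exists v => // F'.
by rewrite inE => /predU1P[->|/H].
Qed.

(** Only a lower bound, since [d] and [m] may coincide: the set is a nonempty fibre of a map of rank
    at most 2. *)
Lemma card_both1 n (d m : 'cV['F_2]_n) : d != 0 -> m != 0 ->
  (2 ^ (n - 2) <= #|[set v : 'cV['F_2]_n | (dot d v == 1%R) && (dot m v == 1%R)]|)%N.
Proof.
move=> d0 m0; have [v0 [dv mv]] := dot_both1 d0 m0.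
pose A := col_mx d^T m^T.
have <- : [set v : 'cV['F_2]_n | A *m v == A *m v0] =
          [set v : 'cV['F_2]_n | (dot d v == 1) && (dot m v == 1)].
  apply/setP=> v; rewrite !inE !mul_col_mx !mul_dot dv mv.
  apply/eqP/andP.
    move/eq_col_mx => [/matrixP/(_ 0 0) + /matrixP/(_ 0 0)].
    by rewrite !mxE !mulr1n => -> ->.
  by case=> /eqP-> /eqP->.
rewrite card_fiber leq_exp2l // leq_sub2l // rank_leq_row //.
Qed.

Lemma card_dot_fiber n (d : 'cV['F_2]_n) (v0 : 'cV['F_2]_n) :
  (2 ^ (n - 1) <= #|[set v : 'cV['F_2]_n | dot d v == dot d v0]|)%N.
Proof.
have <- : [set v : 'cV['F_2]_n | d^T *m v == d^T *m v0] =
          [set v : 'cV['F_2]_n | dot d v == dot d v0].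
  apply/setP=> v; rewrite !inE !mul_dot; apply/eqP/eqP => [|-> //].
  by move/matrixP/(_ 0 0); rewrite !mxE !mulr1n.
by rewrite card_fiber leq_exp2l // leq_sub2l // rank_leq_row.
Qed.

(** * Rank one forms and the steps that lead to them *)

(** An alternate matrix has even rank, so some [y = E u] has [u^T y = 1], and removing its square
    leaves rank 0; the diagonal of [y y^T] recovers [y]. *)
Lemma rank1_sq n (E : 'M['F_2]_n) :
  E^T = E -> \rank E = 1%N -> E = sq (dg E) /\ dg E != 0.
Proof.
move=> sE rE; have dE : dg E != 0.
  by apply/negP=> /eqP/(alternate_rank_even sE); rewrite rE.
split=> //; have [u] := dot_neq0 dE; rewrite -dot_dg // => Eu.
have := rank_addsq_drop sE Eu; rewrite rE => -[] /esym/eqP.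
by rewrite mxrank_eq0 addm_eq0 => /eqP eE; rewrite {2}eE dg_sq.
Qed.

Lemma sq_eq0 n (y : 'cV['F_2]_n) : sq y = 0 -> y = 0.
Proof. by move=> H; rewrite -(dg_sq y) H; apply/matrixP=> i j; rewrite !mxE. Qed.

Lemma rank_sq1 n (y : 'cV['F_2]_n) : y != 0 -> \rank (sq y) = 1%N.
Proof.
move=> y0; apply/eqP; rewrite eqn_leq rank_sq lt0n mxrank_eq0.
by apply: contra y0 => /eqP/sq_eq0->.
Qed.

(* The form [C] after a step along [y]; see [cform_step]. *)
Definition upd n (C : 'M['F_2]_n) (y p : 'cV['F_2]_n) : 'M['F_2]_n :=
  C + (p *m y^T + y *m p^T) + sq p.

Lemma updT n (C : 'M['F_2]_n) y p : C^T = C -> (upd C y p)^T = upd C y p.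
Proof.
by move=> sC; rewrite /upd !linearD /= sC sqT !trmx_mul !trmxK [X in _ + X + _]addrC.
Qed.

Lemma dg_upd n (C : 'M['F_2]_n) y p : dg (upd C y p) = dg C + p.
Proof. by rewrite /upd !dgD -dgD dg_polar dg_sq addr0. Qed.

Lemma sqD n (y e : 'cV['F_2]_n) : sq (y + e) = sq y + (e *m y^T + y *m e^T) + sq e.
Proof.
by rewrite /sq linearD /= mulmxDl !mulmxDr; F2_group.
Qed.

Lemma upd_sq n (C : 'M['F_2]_n) y e f : upd C y e = sq f ->
  C = sq f + sq y + sq (y + e).
Proof.
by move=> <-; rewrite /upd sqD; F2_group.
Qed.

(** Describes the bad steps, those after which the form has rank one. The new form is [f f^T], and
    undoing the step writes [C] as three squares. The new form kills [v], so [f^T v = 0]; if [C v]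
    were 0, the form would not have changed. *)
Lemma upd_rank1_summands n (C : 'M['F_2]_n) (y v : 'cV['F_2]_n) : C^T = C ->
    dot y v = 1 -> dot (dg C) v = 0 -> \rank C != 1%N ->
    \rank (upd C y (C *m v)) = 1%N ->
  exists f, [/\ C = sq f + sq y + sq (y + C *m v), dot (C *m v) v = 0,
                dot f v = 0, C *m v != 0 & f != 0].
Proof.
move=> sC yv sv rC rU; set e := C *m v in rU *.
have ev : dot e v = 0 by rewrite dotC /e dot_dg.
have [fE f0] := rank1_sq (updT y e sC) rU.
set f := dg _ in fE f0; exists f; split=> //.
- exact: upd_sq.
- have : upd C y e *m v = 0.
    rewrite /upd !mulmxDl !mul_dotr yv ev scale1r !scale0r !addr0 -/e.
    exact: addmm.
  rewrite fE sq_mul; case: (F2_cases (dot f v)) => -> //.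
  by rewrite scale1r => /eqP; rewrite (negbTE f0).
- apply: contra rC => /eqP e0; move: rU.
  by rewrite /upd e0 /sq !mul0mx !trmx0 mulmx0 !addr0 => ->.
Qed.

Lemma sum3_mul n (f y g u : 'cV['F_2]_n) :
  (sq f + sq y + sq g) *m u = dot f u *: f + dot y u *: y + dot g u *: g.
Proof. by rewrite !mulmxDl !sq_mul. Qed.

(* [y'] is one of the three summands of [C]: they are the orthonormal basis of
   the form induced by [C], or the nonzero vectors of an alternate plane. *)
Lemma summand_unique n (C : 'M['F_2]_n) (y e f y' e' f' v' : 'cV['F_2]_n) :
    C^T = C -> C = sq f + sq y + sq (y + e) -> C = sq f' + sq y' + sq (y' + e') ->
    dot y' v' = 1 -> dot e' v' = 0 -> dot f' v' = 0 -> e' != 0 ->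
  [\/ y' = f, y' = y | y' = y + e].
Proof.
move=> sC CE CE' yv ev fv e0.
have dC : dg C = f + e by rewrite CE !dgD !dg_sq; F2_group.
have dC' : dg C = f' + e' by rewrite CE' !dgD !dg_sq; F2_group.
have y'0 : y' <> 0 by move=> H; move: yv; rewrite H dot0l.
(* Since [dg C = f + e], the cases are [C] alternate or not. In both, [u] is chosen with [C u = y'],
   and expanding [C u] in [f], [y], [y + e] leaves few values. *)
have [fe|fe] := eqVneq f e.
  have fe' : f' = e' by apply/eqP; rewrite -addm_eq0 -dC' dC fe addmm.
  have [u [eu yu]] : exists u, dot e' u = 1 /\ dot y' u = 0.
    apply: dot_separate => //; apply/eqP => H.
    by move: yv; rewrite -H ev.
  have : C *m u = y'.
    rewrite CE' sum3_mul fe' !dotDl eu yu add0r !scale1r scale0r addr0; F2_group.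
  rewrite CE sum3_mul fe.
  case: (F2_cases (dot e u)) => ->; case: (F2_cases (dot y u)) => ->;
  case: (F2_cases (dot (y + e) u)) => ->; rewrite ?scale0r ?scale1r ?add0r ?addr0 => yE.
  - by case: y'0.
  - by constructor 3.
  - by constructor 2.
  - by constructor 1; rewrite -yE; F2_group.
  - by constructor 1.
  - by constructor 2; rewrite -yE; F2_group.
  - by constructor 3; rewrite -yE; F2_group.
  - by case: y'0; rewrite -yE; F2_group.
have fe' : e' != f'.
  by rewrite eq_sym -addm_eq0 -dC' dC addm_eq0.
have [u [eu fu yu]] : exists u, [/\ dot e' u = 1, dot f' u = 0 & dot y' u = 1].
  have [u [eu fu]] := dot_separate e0 fe'.
  case: (F2_cases (dot y' u)) => yu; last by exists u.
  by exists (u + v'); rewrite !dotDr eu fu yu yv ev fv !addr0 add0r.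
have Cu : C *m u = y'.
  by rewrite CE' sum3_mul !dotDl eu fu yu F2_addrr !scale0r scale1r addr0 add0r.
have : dot u (C *m u) = 1 by rewrite Cu dotC.
rewrite dot_dg // dC dotDl; move: Cu; rewrite CE sum3_mul dotDl.
case: (F2_cases (dot f u)) => ->; case: (F2_cases (dot y u)) => ->;
case: (F2_cases (dot e u)) => ->;
rewrite ?addr0 ?add0r ?F2_addrr ?scale0r ?scale1r ?addr0 ?add0r => yE /eqP //= _.
- by constructor 3.
- by constructor 2.
- by constructor 1.
(* The remaining value [f + e] is [dg C = f' + e'], which is orthogonal to [v'], unlike [y']. *)
- exfalso; have : y' = f' + e' by rewrite -dC' dC -yE; F2_group.
  by move=> H; move: yv; rewrite H dotDl ev fv addr0.
Qed.

(** * Choosing a step that lowers the rank *)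

(** Removing the square of [E v = dg E] lowers the rank by one and leaves an alternate matrix, whose
    rank is even. *)
Lemma canonical_vector_odd n (E : 'M['F_2]_n) v :
  E^T = E -> dot (dg E) v = 1 -> E *m v = dg E -> odd (\rank E).
Proof.
move=> sE dv Ev; have Evv : dot v (E *m v) = 1 by rewrite dot_dg.
rewrite (rank_addsq_drop sE Evv) Ev /= alternate_rank_even //.
  by rewrite linearD /= sE sqT.
by rewrite dgD dg_sq addmm.
Qed.

Lemma rank_le1_of_image m n (C : 'M['F_2]_(m, n)) (s : 'cV['F_2]_m) :
  (forall u : 'cV['F_2]_n, C *m u = 0 \/ C *m u = s) -> (\rank C <= 1)%N.
Proof.
move=> Cu; have : (C^T <= s^T)%MS.
  apply/row_subP => i; rewrite rowE -[delta_mx 0 i]trmxK -trmx_mul.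
  by case: (Cu (delta_mx 0 i)^T) => ->; rewrite ?trmx0 ?sub0mx.
by move/mxrankS; rewrite !mxrank_tr => /leq_trans; apply; apply: rank_leq_col.
Qed.

(** Settles the tight case, with [D + C] as [M] or with the two interchanged. Every [u] with
    [d^T u = m^T u = 0] is 0 or [w] modulo [ker D], so a form vanishing on [ker D], [v] and [w] is 0
    or [d + m]. This applies to [D w], to [M w] and then to the whole image of [D + M]. *)
Lemma rank1_of_no_pick n (D M : 'M['F_2]_n) (v w : 'cV['F_2]_n) :
    D^T = D -> M^T = M -> (forall u : 'cV['F_2]_n, D *m u = 0 <-> M *m u = 0) -> dg D != dg M ->
    dot (dg D) v = 1 -> dot (dg M) v = 1 -> dot (dg D) w = 0 -> dot (dg M) w = 0 ->
    D *m w != 0 -> D *m v = dg D ->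
    (forall u, dot (dg D) u = 1 -> dot (dg M) u = 1 -> D *m u = dg D \/ M *m u = dg M) ->
  \rank (D + M)%R = 1%N.
Proof.
move=> sD sM kDM; set d := dg D; set m := dg M => dm dv mv dw mw Dw Dv bad.
have Mvw : M *m (v + w) = m.
  case: (bad (v + w)); rewrite ?dotDr ?dv ?mv ?dw ?mw ?addr0 // mulmxDr Dv.
  by move/eqP; rewrite -addm_eq0 addrC addrA addmm add0r (negbTE Dw).
have K0 u : dot d u = 0 -> dot m u = 0 -> D *m u = 0 \/ D *m (u + w) = 0.
  move=> du mu; case: (bad (v + u)); rewrite ?dotDr ?dv ?mv ?du ?mu ?addr0 //.
    by rewrite mulmxDr Dv => /eqP; rewrite -addm_eq0 addrC addrA addmm add0r => /eqP; left.
  move=> Mvu; right; apply/kDM.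
  have -> : u + w = (v + u) + (v + w) by F2_group.
  by rewrite mulmxDr Mvu Mvw addmm.
have L f : (forall k : 'cV['F_2]_n, D *m k = 0 -> dot f k = 0) -> dot f w = 0 -> dot f v = 0 ->
    f = 0 \/ f = d + m.
  move=> fk fw fv; have : forall u, dot d u = 0 -> dot m u = 0 -> dot f u = 0.
    move=> u du mu; case: (K0 u du mu) => /fk //.
    by rewrite dotDr fw addr0.
  case/dot_annihilator => fE; [by left|exfalso|exfalso|by right];
  by move: fv; rewrite fE ?dv ?mv.
have kill (E : 'M['F_2]_n) (u k : 'cV['F_2]_n) : E^T = E -> E *m k = 0 -> dot (E *m u) k = 0.
  by move=> sE Ek; rewrite dot_mul // Ek dot0r.
have DwE : D *m w = d + m.
  have Dww : dot (D *m w) w = 0 by rewrite dotC dot_dg.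
  have Dwv : dot (D *m w) v = 0 by rewrite dot_mul // Dv dotC.
  case: (L _ (fun k => kill D w k sD) Dww Dwv) => // H.
  by rewrite H eqxx in Dw.
have MwE : M *m w = d + m.
  have Mww : dot (M *m w) w = 0 by rewrite dotC dot_dg.
  have Mwv : dot (M *m w) v = 0.
    have : dot (M *m w) (v + w) = 0 by rewrite dot_mul // Mvw dotC.
    by rewrite dotDr Mww addr0.
  have Mwk k : D *m k = 0 -> dot (M *m w) k = 0 by move/kDM; apply: kill.
  case: (L _ Mwk Mww Mwv) => // /kDM H.
  by rewrite H eqxx in Dw.
have sC : (D + M)^T = D + M by rewrite linearD /= sD sM.
have Cw : (D + M) *m w = 0 by rewrite mulmxDl DwE MwE addmm.
have Cv : (D + M) *m v = 0.
  have -> : v = (v + w) + w by rewrite addmK.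
  rewrite mulmxDr Cw addr0 mulmxDl Mvw mulmxDr Dv DwE; F2_group.
apply/eqP; rewrite eqn_leq (@rank_le1_of_image _ _ _ (d + m)); last first.
  move=> u; apply: L => [k Dk||]; apply: kill => //.
  by rewrite mulmxDl Dk (proj1 (kDM k) Dk) addr0.
rewrite lt0n mxrank_eq0; apply: contra dm => /eqP C0.
rewrite -addm_eq0 -dgD C0; apply/eqP/matrixP=> i j; by rewrite !mxE.
Qed.

Lemma dot_both0 n (d m : 'cV['F_2]_n) :
  (2 ^ (n - 2) <= #|[set v : 'cV['F_2]_n | (dot d v == 0%R) && (dot m v == 0%R)]|)%N.
Proof.
have <- : [set v : 'cV['F_2]_n | col_mx d^T m^T *m v == 0] =
          [set v : 'cV['F_2]_n | (dot d v == 0) && (dot m v == 0)].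
  apply/setP=> v; rewrite !inE !mul_col_mx !mul_dot -col_mx0.
  apply/eqP/andP.
    move/eq_col_mx => [/matrixP/(_ 0 0) + /matrixP/(_ 0 0)].
    by rewrite !mxE !mulr1n => -> ->.
  by case=> /eqP-> /eqP->; rewrite -scalemx1 scale0r.
by rewrite card_kernel leq_exp2l // leq_sub2l // rank_leq_row.
Qed.

Lemma pow2_sub n r j : (j <= r)%N -> (r <= n)%N ->
  (2 ^ (n - j) = 2 ^ (r - j) * 2 ^ (n - r))%N.
Proof. by move=> jr rn; rewrite -expnD; congr (2 ^ _)%N; lia. Qed.

(** If the diagonals agree, the admissible vectors fill four cosets of [ker D], of which at most two
    are forbidden. Otherwise they fill only two, and if both are forbidden [rank1_of_no_pick]
    contradicts the hypothesis on [D + M]. *)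
Lemma pick_rank3 n (D M : 'M['F_2]_n) :
    D^T = D -> M^T = M -> (forall u : 'cV['F_2]_n, D *m u = 0 <-> M *m u = 0) ->
    dg D != 0 -> dg M != 0 -> \rank D = 3%N -> \rank M = 3%N -> \rank (D + M)%R != 1%N ->
  exists v, [/\ dot (dg D) v = 1, dot (dg M) v = 1, D *m v != dg D & M *m v != dg M].
Proof.
move=> sD sM kDM d0 m0 rD rM rC.
have rn : (3 <= n)%N by rewrite -rD rank_leq_row.
have [dm|dm] := eqVneq (dg D) (dg M).
  have [v0 dv0] := dot_neq0 d0.
  have := @avoid_sets _ (2 ^ (n - 3)) [set v : 'cV['F_2]_n | dot (dg D) v == dot (dg D) v0]
    [:: [set v | D *m v == dg D]; [set v | M *m v == dg M]].
  case=> [F||v].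
  - by rewrite !inE => /orP[]/eqP->; rewrite -?rD -?{1}rM; [|rewrite rD -rM]; apply: card_fiber_le.
  - apply: leq_trans (card_dot_fiber _ _); rewrite (@pow2_sub n 3 1) //.
    by rewrite ltn_mul2r expn_gt0.
  rewrite inE dv0 => /eqP dv av; exists v; rewrite -dm dv; split=> //.
    by have := av _ (mem_head _ _); rewrite inE.
  by have := av [set v | M *m v == dg M]; rewrite !inE dm eqxx orbT => ->.
have [w] : exists2 w, w \in [set v : 'cV['F_2]_n | (dot (dg D) v == 0) && (dot (dg M) v == 0)]
    & forall F, F \in [:: [set v | D *m v == 0]] -> w \notin F.
  apply: (@avoid_sets _ (2 ^ (n - 3))) => [F|].
    by rewrite inE => /eqP->; rewrite -rD; apply: card_fiber_le.
  apply: leq_trans (dot_both0 _ _); rewrite (@pow2_sub n 3 2) //.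
  by rewrite ltn_mul2r expn_gt0.
rewrite inE => /andP[/eqP dw /eqP mw] /(_ _ (mem_head _ _)); rewrite inE => Dw.
pose P v := [&& dot (dg D) v == 1, dot (dg M) v == 1, D *m v != dg D & M *m v != dg M].
have [/existsP[v /and4P[/eqP dv /eqP mv Dv Mv]]|/existsPn nP] := boolP [exists v, P v].
  by exists v.
have bad u : dot (dg D) u = 1 -> dot (dg M) u = 1 -> D *m u = dg D \/ M *m u = dg M.
  move=> du mu; have := nP u; rewrite /P du mu !eqxx /=.
  by rewrite negb_and !negbK => /orP[]/eqP; [left|right].
exfalso; have [v [dv mv]] := dot_both1 d0 m0.
case: (bad v dv mv) => Ev.
  by rewrite (rank1_of_no_pick sD sM kDM dm dv mv dw mw Dw Ev bad) in rC.
have kMD (u : 'cV['F_2]_n) : M *m u = 0 <-> D *m u = 0 by split=> /kDM.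
have Mw : M *m w != 0 by apply: contra Dw => /eqP/kDM->.
have := rank1_of_no_pick sM sD kMD _ mv dv mw dw Mw Ev.
rewrite eq_sym addrC => H; move: rC; rewrite H // => u mu du.
by case: (bad u du mu); [right|left].
Qed.

(** A single bad [v] fixes three summands of [C], and by [summand_unique] any bad [v'] has [D v']
    among them: three cosets of [ker D] at most. *)
Lemma upd_rank1_cover n (D C : 'M['F_2]_n) :
    D^T = D -> C^T = C -> \rank C != 1%N ->
  exists Fs : seq {set 'cV['F_2]_n},
    [/\ (size Fs <= 3)%N, forall F, F \in Fs -> (#|F| <= 2 ^ (n - \rank D))%N
      & forall v, dot (dg D) v = 1 -> dot (dg C) v = 0 ->
        (forall F, F \in Fs -> v \notin F) -> \rank (upd C (D *m v) (C *m v)) != 1%N].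
Proof.
move=> sD sC rC.
have yv v : dot (dg D) v = 1 -> dot (D *m v) v = 1 by move=> <-; rewrite dotC dot_dg.
pose P v := [&& dot (dg D) v == 1, dot (dg C) v == 0
            & \rank (upd C (D *m v) (C *m v)) == 1%N].
have [/existsP[v /and3P[/eqP dv /eqP cv /eqP rv]]|/existsPn nP] := boolP [exists v, P v];
  last first.
  exists [::]; split=> // v dv cv _; have := nP v.
  by rewrite /P dv cv !eqxx.
have [f [CE _ _ _ _]] := upd_rank1_summands sC (yv _ dv) cv rC rv.
set y := D *m v in CE; set e := C *m v in CE.
exists [:: [set v | D *m v == f]; [set v | D *m v == y]; [set v | D *m v == y + e]].
split=> // [F|v' dv' cv' av].
  by rewrite !inE => /or3P[]/eqP->; apply: card_fiber_le.
apply/negP => /eqP rv'.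
have [f' [CE' ev' fv' e0' _]] := upd_rank1_summands sC (yv _ dv') cv' rC rv'.
case: (summand_unique sC CE CE' (yv _ dv') ev' fv' e0') => /eqP H.
- by have := av [set v | D *m v == f]; rewrite !inE eqxx /= H => /(_ isT).
- by have := av [set v | D *m v == y]; rewrite !inE eqxx orbT /= H => /(_ isT).
- by have := av [set v | D *m v == y + e]; rewrite !inE eqxx !orbT /= H => /(_ isT).
Qed.

(** The guards [2 < r] and [3 < r] of the conclusion are the guards [1 < r] and [2 < r] at the next
    rank [r - 1]. The admissible set has room for at least [2^(r-2)] cosets of [ker D]. *)
Lemma pick_step n r (D C : 'M['F_2]_n) :
    D^T = D -> C^T = C -> (C <= D)%MS -> \rank D = r -> \rank (D + C)%R = r ->
    dg D != 0 -> dg (D + C) != 0 -> (1 < r)%N -> ((2 < r)%N -> \rank C != 1%N) ->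
  exists v, [/\ dot (dg D) v = 1, dot (dg C) v = 0,
    (2 < r)%N -> D *m v != dg D /\ (D + C) *m v != dg (D + C) &
    (3 < r)%N -> \rank (upd C (D *m v) (C *m v)) != 1%N].
Proof.
move=> sD sC CD rD rM d0 m0 r1 rC.
set M := D + C in rM m0 *.
have sM : M^T = M by rewrite linearD /= sD sC.
have MD : (M <= D)%MS by apply: addmx_sub.
have DM : (D <= M)%MS.
  by have := mxrank_leqif_sup MD; rewrite rD rM => /leqifP; case: ifP => //; rewrite ltnn.
have kDM (u : 'cV['F_2]_n) : D *m u = 0 <-> M *m u = 0 by split; apply: mul_eq0_sub.
have mE : dg M = dg D + dg C by rewrite dgD.
have cv v : dot (dg D) v = 1 -> dot (dg M) v = 1 -> dot (dg C) v = 0.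
  by rewrite mE dotDl => ->; case: (F2_cases (dot (dg C) v)) => -> // /eqP.
have rn : (r <= n)%N by rewrite -rD rank_leq_row.
have [r3|r3] := ltnP 3 r; last first.
  have [r2|r2] := ltnP 2 r; last first.
    have [v [dv mv]] := dot_both1 d0 m0; exists v; split=> //; exact: cv.
  have re : r = 3%N by lia.
  have rDM : \rank (D + M)%R != 1%N.
    have -> : (D + M)%R = C by rewrite /M; F2_group.
    exact: rC.
  have [v [dv mv Dv Mv]] :=
    pick_rank3 sD sM kDM d0 m0 (etrans rD re) (etrans rM re) rDM.
  by exists v; split=> //; exact: cv.
have {}rC := rC (ltnW r3).
have [Fs [sF cF bF]] := upd_rank1_cover sD sC rC.
pose K := [set v : 'cV['F_2]_n | (dot (dg D) v == 1) && (dot (dg M) v == 1)].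
have cK : (2 ^ (n - 2) <= #|K|)%N by apply: card_both1.
(* In rank 4 the three cosets of the cover are fewer than 4, and the diagonal conditions hold by
   parity. From rank 5 on, all five cosets are fewer than 8. *)
have [r4|r4] := ltnP 4 r; last first.
  have re : r = 4%N by lia.
  have [||v] := @avoid_sets _ (2 ^ (n - r)) K Fs.
  - by rewrite -rD.
  - apply: leq_trans cK; rewrite (pow2_sub r1 rn) ltn_mul2r expn_gt0 /=.
    by rewrite re.
  rewrite inE => /andP[/eqP dv /eqP mv] av; exists v; split=> //; first exact: cv.
    move=> _; split; apply/eqP => /canonical_vector_odd H.
      by move: (H sD dv); rewrite rD re.
    by move: (H sM mv); rewrite rM re.
  by move=> _; apply: bF => //; apply: cv.
have [||v] := @avoid_sets _ (2 ^ (n - r)) K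
  ([set v | D *m v == dg D] :: [set v | M *m v == dg M] :: Fs).
- move=> F; rewrite !inE => /or3P[/eqP->|/eqP->|/cF]; last by rewrite rD.
    by rewrite -rD card_fiber_le.
  by rewrite -rM card_fiber_le.
- apply: leq_trans cK; rewrite (pow2_sub r1 rn) ltn_mul2r expn_gt0 /=.
  have : (2 ^ 3 <= 2 ^ (r - 2))%N by rewrite leq_exp2l; lia.
  by move/(leq_trans _); apply; rewrite !ltnS (leq_trans sF).
rewrite inE => /andP[/eqP dv /eqP mv] av; exists v; split=> //; first exact: cv.
  move=> _; split.
    by have := av _ (mem_head _ _); rewrite inE.
  by have := av [set v | M *m v == dg M]; rewrite !inE eqxx orbT => ->.
move=> _; apply: bF => //; [exact: cv | move=> F FF; apply: av].
by rewrite !inE FF !orbT.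
Qed.

(** * Steps of the graph and their effect on the form [C] *)

(* The difference [B - A] is written [A + B] from here on. *)
Definition cform n (A B : 'M['F_2]_n) : 'M['F_2]_n := (A + B) *m invmx A *m (A + B).

Lemma sgl_sym n (A : 'M['F_2]_n) : sgl A -> A^T = A.
Proof. by case/andP => /eqP. Qed.

Lemma sgl_unit n (A : 'M['F_2]_n) : sgl A -> A \in unitmx.
Proof. by case/andP. Qed.

Lemma sgl_inv_sym n (A : 'M['F_2]_n) : sgl A -> (invmx A)^T = invmx A.
Proof. by move=> /sgl_sym sA; rewrite trmx_inv sA. Qed.

Lemma sgl_add_sym n (A B : 'M['F_2]_n) : sgl A -> sgl B -> (A + B)^T = A + B.
Proof. by move=> /sgl_sym sA /sgl_sym sB; rewrite linearD /= sA sB. Qed.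

(** Sherman-Morrison formula, with denominator [1 + y^T A^-1 y = 1]. *)
Lemma sgl_addsq n (A : 'M['F_2]_n) y : sgl A -> dot y (invmx A *m y) = 0 ->
  sgl (A + sq y) /\ invmx (A + sq y) = invmx A + sq (invmx A *m y).
Proof.
move=> gA yy; have uA := sgl_unit gA; have sA := sgl_sym gA.
have sS := sgl_inv_sym gA; set S := invmx A in yy sS *.
have inv : (A + sq y) *m (S + sq (S *m y)) = 1%:M.
  rewrite mulmxDl !mulmxDr mulmxV // /sq trmx_mul sS !mulmxA mulmxV // mul1mx.
  rewrite -(mulmxA y y^T S) -(mulmxA y (y^T *m S) y) -(mulmxA y^T) mul_dot yy.
  by rewrite mul_mx_scalar scale0r !mul0mx addr0 addmK.
have [uA' _] := mulmx1_unit inv; split.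
  by rewrite /sgl uA' andbT linearD /= sA sqT.
by rewrite -[RHS]mul1mx -(mulVmx uA') -mulmxA inv mulmx1.
Qed.

(** Otherwise [A^-1 y] would be a nonzero kernel vector of [A + y y^T]. *)
Lemma sgl_addsq_isotropic n (A : 'M['F_2]_n) y :
  sgl A -> sgl (A + sq y) -> dot y (invmx A *m y) = 0.
Proof.
move=> gA /sgl_unit uA'; have uA := sgl_unit gA.
case: (F2_cases (dot y (invmx A *m y))) => // yy.
have : (A + sq y) *m (invmx A *m y) = 0.
  by rewrite mulmxDl mulmxA mulmxV // mul1mx sq_mul yy scale1r addmm.
move/(congr1 (mulmx (invmx (A + sq y)))); rewrite mulKmx // mulmx0 => H.
by rewrite H dot0r.
Qed.

Lemma cformT n (A B : 'M['F_2]_n) : sgl A -> sgl B -> (cform A B)^T = cform A B.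
Proof.
move=> gA gB; rewrite /cform !trmx_mul (sgl_inv_sym gA) (sgl_add_sym gA gB).
by rewrite mulmxA.
Qed.

Lemma cform_sub n (A B : 'M['F_2]_n) : (cform A B <= (A + B)%R)%MS.
Proof. exact: submxMl. Qed.

(** Expand with the new inverse; as [y^T A^-1 y = 0], the old and the new difference agree on
    [A^-1 y]. *)
Lemma cform_step n (A B : 'M['F_2]_n) y :
    sgl A -> sgl B -> dot y (invmx A *m y) = 0 ->
  cform (A + sq y) B = upd (cform A B) y ((A + B) *m invmx A *m y).
Proof.
move=> gA gB yy; have [_ invE] := sgl_addsq gA yy.
rewrite /cform invE addrAC; set D := A + B; have sD : D^T = D by apply: sgl_add_sym.
have sS := sgl_inv_sym gA; set S := invmx A in yy sS *.
have sD' : (D + sq y)^T = D + sq y by rewrite linearD /= sD sqT.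
have pE : (D + sq y) *m (S *m y) = D *m S *m y.
  by rewrite mulmxDl sq_mul yy scale0r addr0 mulmxA.
rewrite [_ *m (S + _)]mulmxDr [LHS]mulmxDl.
have -> : (D + sq y) *m sq (S *m y) *m (D + sq y) = sq (D *m S *m y).
  by rewrite -pE /sq (trmx_mul (D + _)) sD' !mulmxA.
rewrite /upd; congr (_ + _).
set p := D *m S *m y in pE *.
rewrite mulmxDr mulmxDl mulmxDl.
have -> : sq y *m S *m D = y *m p^T by rewrite /p /sq !trmx_mul sS sD !mulmxA.
have -> : (D *m S + sq y *m S) *m sq y = p *m y^T.
  by rewrite -mulmxDl /sq mulmxA -(mulmxA _ S y) pE.
by rewrite -addrA [X in _ + X]addrC.
Qed.

(** For [y = D v] the condition [y^T A^-1 y = 0] reads [v^T C v = 0], which is linear in [v]. The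
    last identity tracks the diagonal of [D + C], which must stay nonzero. *)
Lemma cform_step_in n (A B : 'M['F_2]_n) v :
    sgl A -> sgl B -> dot (dg (cform A B)) v = 0 ->
  [/\ sgl (A + sq ((A + B) *m v)),
      cform (A + sq ((A + B) *m v)) B = upd (cform A B) ((A + B) *m v) (cform A B *m v) &
      dg (A + sq ((A + B) *m v) + B + cform (A + sq ((A + B) *m v)) B)
        = dg (A + B + cform A B) + (A + B + cform A B) *m v].
Proof.
move=> gA gB; rewrite -dot_dg ?cformT // => sv.
have yy : dot ((A + B) *m v) (invmx A *m ((A + B) *m v)) = 0.
  by rewrite dot_mul ?sgl_add_sym // !mulmxA.
have [gA' _] := sgl_addsq gA yy; have cE := cform_step gA gB yy.
have {}cE : cform (A + sq ((A + B) *m v)) B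
            = upd (cform A B) ((A + B) *m v) (cform A B *m v).
  by rewrite cE /cform !mulmxA.
split=> //; rewrite cE [A + sq _ + B]addrAC; move: (A + B) (cform A B) => D C.
by rewrite [LHS]dgD dg_upd !dgD dg_sq mulmxDl addrACA.
Qed.

(** [D + C = D A^-1 B], because [A + D = B]. *)
Lemma rank_add_cform n (A B : 'M['F_2]_n) : sgl A -> sgl B ->
  \rank (A + B + cform A B)%R = \rank (A + B)%R.
Proof.
move=> gA gB; have uA := sgl_unit gA; have uB := sgl_unit gB.
have -> : A + B + cform A B = (A + B) *m (invmx A *m B).
  have -> : invmx A *m B = 1%:M + invmx A *m (A + B).
    by rewrite mulmxDr mulVmx // addrA addmm add0r.
  by rewrite mulmxDr mulmx1 mulmxA.
by apply: mxrankMfree; rewrite row_free_unit unitmx_mul unitmx_inv uA uB.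
Qed.

(** * Walks: upper bounds *)

Lemma gamma_walk_cons n k (A A' B : 'M['F_2]_n) :
  gamma_adj A A' -> gamma_walk k A' B -> gamma_walk k.+1 A B.
Proof.
move=> adj [_ [p [sp pp lp]]]; split; first by case/and3P: adj.
by exists (A' :: p); rewrite /= sp adj pp.
Qed.

Lemma gamma_adj_sq n (A : 'M['F_2]_n) y :
  sgl A -> sgl (A + sq y) -> y != 0 -> gamma_adj A (A + sq y).
Proof.
move=> gA gA' y0; apply/and3P; split=> //.
by rewrite opprD addrA subrr sub0r oppmm rank_sq1.
Qed.

(** Induction on the rank: [pick_step] hands the guarded conditions on from [r] to [r - 1]. At rank
    0 the ends coincide, at rank 1 they are adjacent. *)
Lemma gamma_walk_nonalternate n r (A B : 'M['F_2]_n) :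
    sgl A -> sgl B -> \rank (A + B)%R = r ->
    ((1 < r)%N -> dg (A + B) != 0 /\ dg (A + B + cform A B) != 0) ->
    ((2 < r)%N -> \rank (cform A B) != 1%N) ->
  gamma_walk r A B.
Proof.
elim: r A => [|r IH] A gA gB rD nalt rC.
  split=> //; exists [::]; split=> //=.
  by apply/eqP; rewrite -addm_eq0 -mxrank_eq0 rD.
case: r IH rD nalt rC => [|r] IH rD nalt rC.
  split=> //; exists [:: B]; split=> //=.
  by rewrite andbT /gamma_adj gA gB oppmm rD.
have [d0 m0] := nalt isT.
have [v [dv sv avD avC]] := pick_step (sgl_add_sym gA gB) (cformT gA gB)
  (cform_sub A B) rD (etrans (rank_add_cform gA gB) rD) d0 m0 isT rC.
have [gA' cE mE] := cform_step_in gA gB sv.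
set y := (A + B) *m v in gA' cE mE avD.
have Dvv : dot v y = 1 by rewrite dot_dg // sgl_add_sym.
apply: (@gamma_walk_cons _ _ _ (A + sq y)).
  apply: gamma_adj_sq => //; apply/eqP => y0.
  by move: Dvv; rewrite y0 dot0r.
apply: IH => //.
- rewrite addrAC; apply: succn_inj.
  by rewrite -(rank_addsq_drop _ Dvv) ?rD // sgl_add_sym.
- move=> /avD[Dv Mv]; split; last by rewrite mE addm_eq0 eq_sym.
  by rewrite addrAC dgD dg_sq addm_eq0 eq_sym.
- by move=> /avC; rewrite cE.
Qed.

Lemma dg0 n : dg (0 : 'M['F_2]_n) = 0.
Proof. by apply/matrixP=> i j; rewrite !mxE. Qed.

(** If no vector is suitable, the space [s^T u = 0] is [{0, v}] modulo [ker D], so forms vanishing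
    on [ker D] and [v] are 0 or [s]. Hence [D v = s], [C v = 0], and the image of [C] lies in
    [{0, s}]. Then [C = 0] and [s = 0], against [D v != 0]. *)
Lemma pick_alternate n (D C : 'M['F_2]_n) :
    D^T = D -> C^T = C -> dg D = 0 -> (C <= D)%MS ->
    (forall u : 'cV['F_2]_n, (D + C) *m u = 0 -> D *m u = 0) ->
    (0 < \rank D)%N -> \rank C != 1%N ->
  exists v, [/\ dot (dg C) v = 0, D *m v != 0 & (D + C) *m v != dg C].
Proof.
move=> sD sC dD CD kM rD rC; set s := dg C.
have r2 : (1 < \rank D)%N.
  by have := alternate_rank_even sD dD; case: (\rank D) rD => [|[]].
have rn := rank_leq_row D.
have [v] : exists2 v, v \in [set v : 'cV['F_2]_n | dot s v == dot s 0]
    & forall F, F \in [:: [set v | D *m v == 0]] -> v \notin F.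
  apply: (@avoid_sets _ (2 ^ (n - \rank D))) => [F|].
    by rewrite inE => /eqP->; apply: card_fiber_le.
  apply: leq_trans (card_dot_fiber _ _); rewrite mul1n ltn_exp2l //; lia.
rewrite inE dot0r => /eqP sv /(_ _ (mem_head _ _)); rewrite inE => Dv.
pose P v := [&& dot s v == 0, D *m v != 0 & (D + C) *m v != s].
have [/existsP[w /and3P[/eqP sw Dw Mw]]|/existsPn nP] := boolP [exists v, P v].
  by exists w.
have bad u : dot s u = 0 -> D *m u = 0 \/ (D + C) *m u = s.
  move=> su; have := nP u; rewrite /P su eqxx /= negb_and !negbK.
  by case/orP=> /eqP; [left|right].
have Mv : (D + C) *m v = s by case: (bad v sv) => // H; rewrite H eqxx in Dv.
have kC (k : 'cV['F_2]_n) : D *m k = 0 -> C *m k = 0 by apply: mul_eq0_sub.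
have L f : (forall k : 'cV['F_2]_n, D *m k = 0 -> dot f k = 0) -> dot f v = 0 ->
    f = 0 \/ f = s.
  move=> fk fv; have : forall u, dot s u = 0 -> dot s u = 0 -> dot f u = 0.
    move=> u su _; case: (bad u su) => [/fk //|Mu].
    have /kM/fk : (D + C) *m (u + v) = 0 by rewrite mulmxDr Mu Mv addmm.
    by rewrite dotDr fv addr0.
  by case/dot_annihilator; rewrite ?addmm; [left|right|right|left].
have DvE : D *m v = s.
  have Dvv : dot (D *m v) v = 0 by rewrite dotC dot_dg // dD dot0l.
  have Dvk (k : 'cV['F_2]_n) : D *m k = 0 -> dot (D *m v) k = 0.
    by move=> Dk; rewrite dot_mul // Dk dot0r.
  by case: (L _ Dvk Dvv) => // H; rewrite H eqxx in Dv.
have Cv : C *m v = 0.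
  have -> : C = D + C + D by F2_group.
  by rewrite mulmxDl Mv DvE addmm.
have : (\rank C <= 1)%N.
  apply: (@rank_le1_of_image _ _ _ s) => u; apply: L => [k /kC Ck|];
  by rewrite dot_mul // ?Ck ?Cv dot0r.
rewrite leq_eqVlt (negbTE rC) ltnS leqn0 mxrank_eq0 => /eqP C0.
by move: Dv; rewrite DvE /s C0 dg0 eqxx.
Qed.

(** A congruence: with [c = C v] and the involution [E = 1 + y v^T], the new form is
    [E (C + c c^T) E^T]. *)
Lemma rank_upd n (C : 'M['F_2]_n) (y v : 'cV['F_2]_n) :
    C^T = C -> dot v y = 0 -> dot v (C *m v) = 0 ->
  \rank (upd C y (C *m v)) = \rank C.
Proof.
move=> sC vy vCv; rewrite -(rank_addsq_keep sC vCv).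
set c := C *m v in vCv *; set C1 := C + sq c.
have sC1 : C1^T = C1 by rewrite linearD /= sC sqT.
have C1v : C1 *m v = c by rewrite mulmxDl sq_mul dotC vCv scale0r addr0.
pose E := 1%:M + y *m v^T.
have EE : E *m E = 1%:M.
  rewrite {2}/E mulmxDr mulmx1 {2}/E mulmxDl mul1mx mulmxA mul_dotr vy.
  by rewrite scale0r mul0mx addr0 addmK.
have [uE _] := mulmx1_unit EE.
have -> : upd C y c = E *m C1 *m E^T.
  have -> : E^T = 1%:M + v *m y^T by rewrite linearD /= trmx1 trmx_mul trmxK.
  have -> : E *m C1 = C1 + y *m c^T.
    by rewrite mulmxDl mul1mx -C1v trmx_mul sC1 mulmxA.
  rewrite mulmxDr mulmx1 mulmxA mulmxDl C1v mul_dotr dotC vCv scale0r addr0.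
  by rewrite /upd /C1; F2_group.
rewrite mxrankMfree ?row_free_unit ?unitmx_tr //.
by rewrite -mxrank_tr trmx_mul mxrankMfree ?row_free_unit ?unitmx_tr // mxrank_tr.
Qed.

Lemma ker_add_cform n (A B : 'M['F_2]_n) (u : 'cV['F_2]_n) : sgl A -> sgl B ->
  (A + B + cform A B) *m u = 0 -> (A + B) *m u = 0.
Proof.
move=> gA gB; apply: mul_eq0_sub.
have sub : ((A + B + cform A B)%R <= (A + B)%R)%MS.
  by apply: addmx_sub (submx_refl _) (cform_sub A B).
have := mxrank_leqif_sup sub; rewrite rank_add_cform // => /leqifP.
by case: ifP => //; rewrite ltnn.
Qed.

(** A first step in the column space keeps the ranks of [D] and [C] and makes [D] and [D + C]
    nonalternate; [r] steps remain. *)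
Lemma gamma_walk_alternate n r (A B : 'M['F_2]_n) :
    sgl A -> sgl B -> \rank (A + B)%R = r -> (0 < r)%N -> dg (A + B) = 0 ->
    \rank (cform A B) != 1%N ->
  gamma_walk r.+1 A B.
Proof.
move=> gA gB rD r0 dD rC; have sD := sgl_add_sym gA gB; have sC := cformT gA gB.
have [|v [sv Dv Mv]] :=
  pick_alternate sD sC dD (cform_sub A B) (fun u => ker_add_cform (u := u) gA gB) _ rC.
  by rewrite rD.
have [gA' cE mE] := cform_step_in gA gB sv.
set y := (A + B) *m v in gA' cE mE Dv.
have vy : dot v y = 0 by rewrite dot_dg // dD dot0l.
apply: (@gamma_walk_cons _ _ _ (A + sq y)); first exact: gamma_adj_sq.
apply: gamma_walk_nonalternate => // [|_|_].
- by rewrite addrAC rank_addsq_keep.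
- split; first by rewrite addrAC dgD dg_sq dD add0r.
  by rewrite mE addm_eq0 dgD dD add0r eq_sym.
- by rewrite cE rank_upd // dot_dg.
Qed.

(** Symmetry of [p q^T] makes [p] and [q] proportional, hence equal over F2. *)
Lemma polar_eq0 n (p q : 'cV['F_2]_n) :
  p *m q^T + q *m p^T = 0 -> p != 0 -> q != 0 -> p = q.
Proof.
move=> /eqP; rewrite addm_eq0 => /eqP pq p0 q0; have [u qu] := dot_neq0 q0.
have := congr1 (mulmx^~ u) pq; rewrite /= !mul_dotr qu scale1r.
case: (F2_cases (dot p u)) => ->; rewrite ?scale1r // scale0r => pE.
by rewrite pE eqxx in p0.
Qed.

(** The first step, along [z] outside the column space, raises the rank to [r + 1]; a descent of
    [r + 1] steps follows. *)
Lemma gamma_walk_rank1 n r (A B : 'M['F_2]_n) :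
    sgl A -> sgl B -> \rank (A + B)%R = r -> (1 < r)%N -> dg (A + B) = 0 ->
    \rank (cform A B) = 1%N ->
  gamma_walk r.+2 A B.
Proof.
move=> gA gB rD r1 dD rC; have sD := sgl_add_sym gA gB; have sC := cformT gA gB.
have [] := rank1_sq sC rC; set s := dg _ => CE s0.
have sS := sgl_inv_sym gA; set S := invmx A in sS.
set D := A + B in rD dD sD; set C := cform A B in rC sC CE.
have DSD u : D *m S *m (D *m u) = dot s u *: s by rewrite -sq_mul -CE /C /cform !mulmxA.
have [v sv] := dot_neq0 s0.
have sE : s = D *m (S *m (D *m v)) by rewrite mulmxA DSD sv scale1r.
(* Without such a [z], [D S] sends every isotropic vector of [S] into [{0, s}]. As [D v] is not
   isotropic and goes to [s], adding it extends this to all vectors, and [D] would have rank at most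
   1. *)
have [z [zz pz0 pzs]] : exists z, [/\ dot z (S *m z) = 0, D *m S *m z != 0 & D *m S *m z != s].
  pose P z := [&& dot z (S *m z) == 0, D *m S *m z != 0 & D *m S *m z != s].
  have [/existsP[z /and3P[/eqP zz z0 zs]]|/existsPn nP] := boolP [exists z, P z].
    by exists z.
  have bad u : dot (dg S) u = 0 -> D *m S *m u = 0 \/ D *m S *m u = s.
    rewrite -dot_dg // => su; have := nP u; rewrite /P su eqxx /= negb_and !negbK.
    by case/orP=> /eqP; [left|right].
  have : (\rank (D *m S) <= 1)%N.
    apply: (@rank_le1_of_image _ _ _ s) => u.
    case: (F2_cases (dot (dg S) u)) => [/bad //|su].
    have x0 : dot (dg S) (D *m v) = 1.
      rewrite -dot_dg // dot_mul // mulmxA -/D.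
      by rewrite mulmxA -(mulmxA (D *m S)) DSD sv scale1r dotC.
    case: (bad (u + D *m v)); rewrite ?dotDr ?su ?x0 ?F2_addrr // mulmxDr DSD sv scale1r.
      by move/eqP; rewrite addm_eq0 => /eqP; right.
    by move/eqP; rewrite -addm_eq0 addmK => /eqP; left.
  rewrite mxrankMfree ?row_free_unit ?unitmx_inv ?(sgl_unit gA) // rD; lia.
set p := D *m S *m z in pz0 pzs.
have zD u : z <> D *m u.
  move=> zE; move: pz0 pzs; rewrite /p zE DSD.
  by case: (F2_cases (dot s u)) => ->; rewrite ?scale0r ?scale1r eqxx.
have z0 : z != 0 by apply/eqP => z0; apply: (zD 0); rewrite mulmx0.
have zsp : z != s + p.
  apply/eqP=> zE; apply: (zD (S *m (D *m v) + S *m z)).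
  by rewrite mulmxDr -sE mulmxA.
have zs : z + s != 0 by rewrite addm_eq0; apply/eqP => zE; apply: (zD (S *m (D *m v))); rewrite -sE.
have [gA' _] := sgl_addsq gA zz.
have cE := cform_step gA gB zz; rewrite -/C -/D -/S -/p in cE.
apply: (@gamma_walk_cons _ _ _ (A + sq z)); first exact: gamma_adj_sq.
apply: gamma_walk_nonalternate => // [|_|_].
- by rewrite addrAC rank_addsq_up ?rD.
- rewrite cE addrAC -/D; split; first by rewrite dgD dg_sq dD add0r.
  by rewrite dgD dg_upd dgD dg_sq dD add0r addm_eq0.
(* A new form of rank one would be the square of its diagonal [s + p]. Comparison with [upd] gives
   [p (z + s)^T + (z + s) p^T = 0], so [p = z + s], which [zsp] excludes. *)
apply/negP => /eqP rC'; have sC' := updT z p sC; rewrite cE in rC'.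
have [fE _] := rank1_sq sC' rC'; move: fE; rewrite dg_upd -/s sqD /upd CE.
move=> /addIr/addrI fE.
have /polar_eq0/(_ pz0 zs) pE : p *m (z + s)^T + (z + s) *m p^T = 0.
  rewrite linearD /= mulmxDr mulmxDl addrACA fE; exact: addmm.
by case/negP: zsp; rewrite pE; apply/eqP; F2_group.
Qed.

(** * Walks: lower bounds *)

Lemma gamma_walk0 n (A B : 'M['F_2]_n) : gamma_walk 0 A B -> A = B.
Proof. by case=> _ [p [/size0nil -> _]]. Qed.

Lemma gamma_walk_inv n k (A B : 'M['F_2]_n) : gamma_walk k.+1 A B ->
  exists y, [/\ sgl A, dot y (invmx A *m y) = 0 & gamma_walk k (A + sq y) B].
Proof.
case=> gA [[|A' p] [//= [sp] /andP[/and3P[_ gA' /eqP rE] pp] lp]].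
have sE : (A - A')^T = A - A' by rewrite oppmm sgl_add_sym.
have [] := rank1_sq sE rE; rewrite oppmm; set y := dg _ => yE _.
have A'E : A' = A + sq y by rewrite -yE addrA addmm add0r.
rewrite A'E in gA' pp lp.
exists y; split=> //; first exact: sgl_addsq_isotropic.
by split=> //; exists p.
Qed.

Lemma gamma_walk_rank_le n k (A B : 'M['F_2]_n) :
  gamma_walk k A B -> (\rank (A + B)%R <= k)%N.
Proof.
elim: k A => [|k IH] A; first by move/gamma_walk0=> ->; rewrite addmm mxrank0.
case/gamma_walk_inv=> y [_ _ /IH]; rewrite -ltnS => rD'; apply: leq_trans rD'.
by rewrite -{1}(addmK A (sq y)) (addrAC _ (sq y) B) rank_addsq.
Qed.

Lemma column_space_dec n (D : 'M['F_2]_n) (y : 'cV['F_2]_n) :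
  (exists v, y = D *m v) \/ (forall v, y <> D *m v).
Proof.
have [/existsP[v /eqP ->]|/existsPn H] := boolP [exists v, y == D *m v].
  by left; exists v.
by right=> v; apply/eqP.
Qed.

(** The first step keeps the rank if it is in the column space and raises it otherwise, so at least
    [rank D] steps remain after it. *)
Lemma alternate_walk_gt n k (A B : 'M['F_2]_n) :
    sgl B -> dg (A + B) = 0 -> (0 < \rank (A + B)%R)%N -> gamma_walk k A B ->
  (\rank (A + B)%R < k)%N.
Proof.
move=> gB dD; case: k => [|k] rD; first by move/gamma_walk0=> H; rewrite H addmm mxrank0 in rD.
case/gamma_walk_inv=> y [gA _ /gamma_walk_rank_le]; rewrite ltnS; apply: leq_trans.
have sD := sgl_add_sym gA gB; rewrite addrAC.
case: (column_space_dec (A + B) y) => [[v ->]|/(rank_addsq_up sD) ->] //.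
by rewrite rank_addsq_keep // dot_dg // dD dot0l.
Qed.

(** Isotropy of [y = D v] means [s^T v = 0], so [p = C v = 0]. *)
Lemma cform_rank1_step n (A B : 'M['F_2]_n) s v : sgl A -> sgl B ->
    dot ((A + B) *m v) (invmx A *m ((A + B) *m v)) = 0 -> cform A B = sq s ->
  cform (A + sq ((A + B) *m v)) B = sq s.
Proof.
move=> gA gB yy CE; have sD := sgl_add_sym gA gB.
have Cv : (A + B) *m invmx A *m ((A + B) *m v) = 0.
  move: yy; rewrite dot_mul // !mulmxA -/(cform A B) CE sq_mul.
  by case: (F2_cases (dot s v)) => sv; rewrite sv ?scale0r // scale1r dotC sv.
rewrite cform_step // Cv CE /upd /sq trmx0 !(mul0mx, mulmx0) !addr0 //.
Qed.

(** Such a walk lowers the rank at every step, so it stays in the column spaces, where [C] is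
    constant; at its end [C] would be 0. *)
Lemma rank1_no_walk n k (A B : 'M['F_2]_n) s :
    sgl B -> s != 0 -> \rank (A + B)%R = k -> cform A B = sq s -> ~ gamma_walk k A B.
Proof.
move=> gB s0; elim: k A => [|k IH] A rD CE.
  move/gamma_walk0=> AB; move: CE; rewrite /cform AB addmm !mul0mx => /esym/sq_eq0 H.
  by rewrite H eqxx in s0.
case/gamma_walk_inv=> y [gA yy wk]; have rk := gamma_walk_rank_le wk.
have sD := sgl_add_sym gA gB; move: rk; rewrite addrAC.
case: (column_space_dec (A + B) y) => [[v yE]|/(rank_addsq_up sD) ->]; last by rewrite rD; lia.
move=> rk; apply: (IH (A + sq y)) wk; last by subst y; apply: cform_rank1_step.
apply/eqP; rewrite addrAC eqn_leq rk -ltnS -rD.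
by rewrite -{1}(addmK (A + B) (sq y)) rank_addsq.
Qed.

(** A first step outside the column space raises the rank above the number of steps left; one inside
    keeps the rank and [C], and [rank1_no_walk] applies. *)
Lemma alternate_rank1_no_walk n (A B : 'M['F_2]_n) :
    sgl A -> sgl B -> dg (A + B) = 0 -> \rank (cform A B) = 1%N ->
  ~ gamma_walk (\rank (A + B)%R).+1 A B.
Proof.
move=> gA gB dD rC; have [] := rank1_sq (cformT gA gB) rC.
set s := dg _ => CE s0 /gamma_walk_inv[y [_ yy wk]].
have sD := sgl_add_sym gA gB; have rk := gamma_walk_rank_le wk.
case: (column_space_dec (A + B) y) => [[v yE]|/(rank_addsq_up sD) H]; last first.
  by move: rk; rewrite addrAC H ltnn.
apply: (@rank1_no_walk _ _ _ _ s gB s0 _ _ wk); last by subst y; apply: cform_rank1_step.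
by rewrite addrAC yE rank_addsq_keep // dot_dg // dD dot0l.
Qed.

(** * From the vectors [x i] to the ranks of [D] and [C] *)

Lemma dg_sum n (I : finType) (F : I -> 'M['F_2]_n) : dg (\sum_i F i) = \sum_i dg (F i).
Proof. exact: (big_morph (@dg n) (@dgD n) (dg0 n)). Qed.

Lemma dot_suml n (I : finType) (F : I -> 'cV['F_2]_n) u :
  dot (\sum_i F i) u = \sum_i dot (F i) u.
Proof. by rewrite (big_morph (fun f => dot f u) (fun f g => dotDl f g u) (dot0l u)). Qed.

(** Vectors [u j] dual to the first [r] vectors satisfy [D u_j = x_j + x_max]. Their sum over [j] is
    [x_max], since [r x_max = 0] for even [r]; so every [x i] is in the column space of [D]. *)
Lemma rows_span_sumsq n r (x : 'I_r.+1 -> 'cV['F_2]_n) : ~~ odd r ->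
    row_free (\matrix_(i < r) (x (widen_ord (leqnSn r) i))^T) ->
    x ord_max = \sum_(i < r) x (widen_ord (leqnSn r) i) ->
  (\matrix_(i < r.+1) (x i)^T <= (\sum_i sq (x i))%R)%MS.
Proof.
move=> evr; set w := widen_ord _; set X0 := \matrix_(i < r) _ => /row_freeP[W XW] xmax.
set D : 'M_n := \sum_i sq (x i).
have sD : D^T = D by rewrite linear_sum /=; apply: eq_bigr => i _; rewrite sqT.
pose u j := col j W.
have xu i j : dot (x (w i)) (u j) = (i == j)%:R.
  have := congr1 (fun M : 'M_r => M i j) XW; rewrite !mxE => <-.
  by rewrite /dot mxE; apply: eq_bigr => k _; rewrite !mxE.
have Du j : D *m u j = x (w j) + x ord_max.
  rewrite mulmx_suml big_ord_recr /=; congr (_ + _).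
    rewrite (bigD1 j) //= sq_mul xu eqxx scale1r big1 ?addr0 // => i ij.
    by rewrite sq_mul xu (negbTE ij) scale0r.
  rewrite sq_mul {1}xmax dot_suml (bigD1 j) //= xu eqxx big1 ?addr0 ?scale1r // => i ij.
  by rewrite xu (negbTE ij).
have xm : x ord_max = D *m \sum_j u j.
  rewrite mulmx_sumr (eq_bigr _ (fun j _ => Du j)) big_split /= -xmax.
  rewrite sumr_const card_ord -scaler_nat.
  have -> : r%:R = 0 :> 'F_2 by rewrite -[r]odd_double_half (negbTE evr) add0n -addnn natrD F2_addrr.
  by rewrite scale0r addr0.
have sub (y v : 'cV['F_2]_n) : y = D *m v -> (y^T <= D)%MS by move=> ->; rewrite trmx_mul sD submxMl.
apply/row_subP=> i; rewrite rowK; case: (unliftP ord_max i) => [j ->|->]; last exact: sub xm.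
have -> : lift ord_max j = w j by apply: val_inj; rewrite /= /bump leqNgt ltn_ord.
by apply: (sub _ (u j + \sum_k u k)); rewrite mulmxDr Du -xm addmK.
Qed.

Theorem theorem2p3 (n r : nat) (A B : 'M['F_2]_n) (x : 'I_r.+1 -> 'cV['F_2]_n) :
  (0 < n)%N -> sgl A -> sgl B ->
  (0 < r)%N -> ~~ odd r ->
  row_free (\matrix_(i < r) (x (widen_ord (leqnSn r) i))^T) ->
  x ord_max = \sum_(i < r) x (widen_ord (leqnSn r) i) ->
  B - A = \sum_(i < r.+1) x i *m (x i)^T ->
  let G := \matrix_(i < r.+1, j < r.+1) ((x i)^T *m invmx A *m x j) 0 0 in
  (\rank G != 1%N -> gamma_dist A B r.+1) /\
  (\rank G = 1%N -> gamma_dist A B r.+2).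
Proof.
move=> _ gA gB r0 evr free xmax; rewrite oppmm addrC => DE G.
have Xsub := rows_span_sumsq evr free xmax.
set X := \matrix_i (x i)^T in Xsub.
have DX : A + B = X^T *m X.
  rewrite DE; apply/matrixP=> i j; rewrite !mxE summxE; apply: eq_bigr => k _.
  by rewrite !mxE big_ord_recl big_ord0 addr0 !mxE.
rewrite -[X in (_ <= X)%MS]DE in Xsub.
(* The diagonal is the sum of all [x i], that is, twice [x ord_max]. *)
have dD : dg (A + B) = 0.
  rewrite DE dg_sum (eq_bigr x) => [|i _]; last exact: dg_sq.
  by rewrite big_ord_recr /= -xmax addmm.
have rX : \rank X = r.
  set X0 := \matrix_i _ in free; apply: etrans (eqP free).
  have X0E i : row i X0 = row (widen_ord (leqnSn r) i) X by rewrite !rowK.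
  apply/eqP; rewrite eqn_leq; apply/andP; split; apply: mxrankS; apply/row_subP=> i; last first.
    by rewrite X0E row_sub.
  have sub j : ((x (widen_ord (leqnSn r) j))^T <= X0)%MS.
    by have := row_sub j X0; rewrite rowK.
  rewrite rowK; case: (unliftP ord_max i) => [j ->|->].
    have -> // : lift ord_max j = widen_ord (leqnSn r) j.
    by apply: val_inj; rewrite /= /bump leqNgt ltn_ord.
  by rewrite xmax linear_sum /=; apply: summx_sub => j _.
have rD : \rank (A + B)%R = r.
  apply: etrans rX; apply/eqP; rewrite eqn_leq (mxrankS Xsub) andbT DX.
  exact: mxrankM_maxr.
have GE : G = X *m invmx A *m X^T.
  apply/matrixP=> i j; rewrite !mxE; apply: eq_bigr => k _.
  rewrite !mxE; congr (_ * _); apply: eq_bigr => l _.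
  by rewrite !mxE.
(* [C = X^T G X]; conversely [X = Z D] gives [G = Z C Z^T]. *)
have rG : \rank G = \rank (cform A B).
  apply/eqP; rewrite eqn_leq; apply/andP; split.
    have sD := sgl_add_sym gA gB; have [Z XE] := submxP Xsub.
    have -> : G = Z *m cform A B *m Z^T.
      by rewrite GE XE trmx_mul sD /cform !mulmxA.
    exact: leq_trans (mxrankM_maxl _ _) (mxrankM_maxr _ _).
  have -> : cform A B = X^T *m G *m X by rewrite /cform DX GE !mulmxA.
  exact: leq_trans (mxrankM_maxl _ _) (mxrankM_maxr _ _).
have r1 : (1 < r)%N by case: (r) r0 evr => [|[]].
have low k : gamma_walk k A B -> (r < k)%N.
  by move=> wk; have := alternate_walk_gt gB dD _ wk; rewrite rD; apply.
rewrite rG; split=> rC; split.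
- exact: gamma_walk_alternate.
- by move=> k kr /low; rewrite ltnNge -ltnS kr.
- exact: gamma_walk_rank1.
move=> k; rewrite ltnS leq_eqVlt => /predU1P[-> wk|kr /low].
  by apply: (alternate_rank1_no_walk gA gB dD rC); rewrite rD.
by rewrite ltnNge -ltnS kr.
Qed.
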